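(* Let $c\in\{-1,0,1\}$, fix $\alpha\in(0,\pi/2]$ and let $\gamma:[0,\ell]\to M_c$ be a smooth, arc-length parametrized, convex, closed, positively oriented curve. The $\alpha$-evolutoid $\gamma_\alpha(s)=\exp^c_{\gamma(s)}(\rho_\alpha(s)\mathbf{v}_\alpha(s))$ of $\gamma$ is regular (i.e. $\gamma_\alpha'(s)\neq0$ for all $s\in[0,\ell]$) if and only if $$\rho_\alpha'(s)\neq-\cos(\alpha)\quad\text{for all } s\in[0,\ell].$$
   Context: Space forms: for $c\in\{-1,0,1\}$ equip $\mathbb{R}^3$ with $\langle x,y\rangle_c=c\,x_1y_1+x_2y_2+x_3y_3$ and $\|x\|_c=\sqrt{\langle x,x\rangle_c}$. Let $M_{-1}=\{x:\langle x,x\rangle_{-1}=-1,\ x_1>0\}$, $M_0=\{x: x_1=0\}$, $M_1=\{x:\langle x,x\rangle_1=1\}$, each with the Riemannian metric induced by $\langle\cdot,\cdot\rangle_c$ (constant Gaussian curvature $c$). Trigonometry: $\sin_c(t)=\sinh t,\ t,\ \sin t$ and $\cos_c(t)=\cosh t,\ 1,\ \cos t$ for $c=-1,0,1$ respectively; $\tan_c=\sin_c/\cos_c$ and $\arctan_c$ is its inverse (principal value for $c=1$). For $p\in M_c$, a unit vector $v\in T_pM_c$ and $t\in\mathbb{R}$, the exponential map is $\exp^c_p(tv)=\cos_c(t)\,p+\sin_c(t)\,v$. Frenet frame: for an arc-length parametrized curve $\gamma$ in $M_c$, $\mathbf{t}=\gamma'$ and $\mathbf{e}=\gamma\wedge_c\mathbf{t}$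 if $c=\pm1$, where $x\wedge_c y=(c(x_2y_3-x_3y_2),\,x_3y_1-x_1y_3,\,x_1y_2-x_2y_1)$, while $\mathbf{e}=\gamma''/\|\gamma''\|_0$ if $c=0$. The geodesic curvature $k$ is defined by $\nabla_{\gamma'}\gamma'=k\,\mathbf{e}$. A smooth, closed, positively oriented, arc-length parametrized curve is called convex if $k(s)>0$ for all $s$ (when $c=0,1$) or $k(s)>1$ for all $s$ (when $c=-1$). Evolutoids: for $\alpha\in[0,\pi/2]$, $\mathbf{v}_\alpha(s)=\cos(\alpha)\mathbf{t}(s)+\sin(\alpha)\mathbf{e}(s)$, $\rho_\alpha(s)=\arctan_c(\sin(\alpha)/k(s))$, and the $\alpha$-evolutoid of $\gamma$ is the curve $\gamma_\alpha(s)=\exp^c_{\gamma(s)}(\rho_\alpha(s)\mathbf{v}_\alpha(s))$. *)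

(* Defs.v *)
From Stdlib Require Import Reals Lra Lia ZArith Nsatz.
From Coquelicot Require Import Coquelicot.
Open Scope R_scope.

Definition R3 : Type := (R * R * R)%type.

Definition x1 (v : R3) : R := fst (fst v).
Definition x2 (v : R3) : R := snd (fst v).
Definition x3 (v : R3) : R := snd v.

Definition inner (c : Z) (x y : R3) : R :=
  IZR c * x1 x * x1 y + x2 x * x2 y + x3 x * x3 y.

Definition norm_c (c : Z) (x : R3) : R := sqrt (inner c x x).

Definition wedge (c : Z) (x y : R3) : R3 :=
  (IZR c * (x2 x * x3 y - x3 x * x2 y),
   x3 x * x1 y - x1 x * x3 y,
   x1 x * x2 y - x2 x * x1 y).

(** The parameter [c] is an integer only so that one can match on its sign;
    everything below is meant for [c] equal to -1, 0 or 1. *)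
Definition space_form (c : Z) (x : R3) : Prop :=
  match c with
  | Z0 => x1 x = 0
  | Zpos _ => inner c x x = IZR c
  | Zneg _ => inner c x x = IZR c /\ 0 < x1 x
  end.

Definition sin_c (c : Z) (t : R) : R :=
  match c with Z0 => t | Zpos _ => sin t | Zneg _ => sinh t end.

Definition cos_c (c : Z) (t : R) : R :=
  match c with Z0 => 1 | Zpos _ => cos t | Zneg _ => cosh t end.

Definition tan_c (c : Z) (t : R) : R := sin_c c t / cos_c c t.

Definition arctan_c (c : Z) (x : R) : R :=
  match c with
  | Z0 => x
  | Zpos _ => atan x
  | Zneg _ => / 2 * ln ((1 + x) / (1 - x))
  end.

Lemma tan_c_arctan_c (c : Z) (x : R) :
  ((c < 0)%Z -> -1 < x < 1) -> tan_c c (arctan_c c x) = x.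
Proof.
destruct c as [|p|p]; unfold tan_c, arctan_c, sin_c, cos_c; intros hx.
- field.
- exact (tan_atan x).
- assert (h := hx (Zlt_neg_0 p)).
  assert (hq : 0 < (1 + x) / (1 - x)) by (apply Rdiv_lt_0_compat; lra).
  set (u := exp (/ 2 * ln ((1 + x) / (1 - x)))).
  assert (hu : 0 < u) by apply exp_pos.
  assert (huu : u * u = (1 + x) / (1 - x)).
  { unfold u; rewrite <- exp_plus.
    rewrite <- (exp_ln _ hq) at 3; f_equal; field. }
  assert (huu' : u * u * (1 - x) = 1 + x) by (rewrite huu; field; lra).
  unfold sinh, cosh; rewrite exp_Ropp; fold u.
  assert (hd : 0 < u + / u) by (assert (h0 := Rinv_0_lt_compat u hu); lra).
  replace ((u - / u) / 2 / ((u + / u) / 2)) with ((u * u - 1) / (u * u + 1)).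
  + apply (Rmult_eq_reg_r (u * u + 1)); [|nra].
    replace ((u * u - 1) / (u * u + 1) * (u * u + 1)) with (u * u - 1)
      by (field; nra).
    lra.
  + field; repeat split; nra.
Qed.

Lemma arctan_c_tan_c (c : Z) (t : R) :
  ((0 < c)%Z -> - (PI / 2) < t < PI / 2) -> arctan_c c (tan_c c t) = t.
Proof.
destruct c as [|p|p]; unfold tan_c, arctan_c, sin_c, cos_c; intros ht.
- field.
- apply (atan_tan t); apply ht; reflexivity.
- unfold sinh, cosh; rewrite exp_Ropp; set (u := exp t).
  assert (hu : 0 < u) by apply exp_pos.
  replace ((1 + (u - / u) / 2 / ((u + / u) / 2)) /
           (1 - (u - / u) / 2 / ((u + / u) / 2))) with (u * u).
  + rewrite ln_mult by assumption; unfold u; rewrite ln_exp; field.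
  + field; repeat split; nra.
Qed.

(** [expmap c p t v] is the exponential of [t v] at [p], for a unit [v]. *)
Definition expmap (c : Z) (p : R3) (t : R) (v : R3) : R3 :=
  plus (scal (cos_c c t) p) (scal (sin_c c t) v).

Definition smooth (g : R -> R3) : Prop :=
  forall (n : nat) (s : R),
    ex_derive_n (fun u => x1 (g u)) n s /\
    ex_derive_n (fun u => x2 (g u)) n s /\
    ex_derive_n (fun u => x3 (g u)) n s.

Definition deriv (g : R -> R3) (s : R) : R3 :=
  (Derive (fun u => x1 (g u)) s,
   Derive (fun u => x2 (g u)) s,
   Derive (fun u => x3 (g u)) s).

(** A smooth closed curve parametrized by [[0, l]] (the derivatives of every
    order agree at the endpoints) is given by its [l]-periodic extension to the
    real line, so that derivatives at [0] and [l] are ordinary ones. *)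
Definition closed_curve (l : R) (g : R -> R3) : Prop :=
  forall s : R, g (s + l) = g s.

Definition arc_length (c : Z) (g : R -> R3) : Prop :=
  forall s : R, norm_c c (deriv g s) = 1.

Definition tangent (g : R -> R3) : R -> R3 := deriv g.

Definition frenet_normal (c : Z) (g : R -> R3) (s : R) : R3 :=
  match c with
  | Z0 => scal (/ norm_c 0 (deriv (deriv g) s)) (deriv (deriv g) s)
  | _ => wedge c (g s) (tangent g s)
  end.

(** Levi-Civita derivative of the velocity: the projection of the second
    derivative to the tangent space of [space_form c], which for [c] = -1, 1 is
    the orthogonal of [g s], with [inner c (g s) (g s) = c]. *)
Definition cov_accel (c : Z) (g : R -> R3) (s : R) : R3 :=
  minus (deriv (deriv g) s)
        (scal (IZR c * inner c (deriv (deriv g) s) (g s)) (g s)).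

(** The coefficient of [cov_accel] along the normal; see [geod_curvatureP]. *)
Definition geod_curvature (c : Z) (g : R -> R3) (s : R) : R :=
  inner c (cov_accel c g s) (frenet_normal c g s).

Lemma R3_eq (v w : R3) : x1 v = x1 w -> x2 v = x2 w -> x3 v = x3 w -> v = w.
Proof.
destruct v as [[a b] d], w as [[a' b'] d']; unfold x1, x2, x3; simpl.
intros -> -> ->; reflexivity.
Qed.

Lemma coord_minus_scal (v w : R3) (a : R) :
  minus v (scal a w) =
  (x1 v - a * x1 w, x2 v - a * x2 w, x3 v - a * x3 w).
Proof. now destruct v as [[? ?] ?], w as [[? ?] ?]. Qed.

Lemma coord_scal (v : R3) (a : R) :
  scal a v = (a * x1 v, a * x2 v, a * x3 v).
Proof. now destruct v as [[? ?] ?]. Qed.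

Lemma smooth_deriv (g : R -> R3) : smooth g -> smooth (deriv g).
Proof.
intros hg n s; destruct (hg (S n) s) as (h1 & h2 & h3).
destruct n as [|n]; [repeat split|].
unfold deriv, x1, x2, x3 in *; cbn [fst snd].
assert (E : forall f : R -> R, ex_derive_n f (S (S n)) s ->
            ex_derive_n (fun u => Derive f u) (S n) s).
{ intros f hf; simpl in *.
  apply (ex_derive_ext (Derive_n f (S n))); [|exact hf].
  intros u; change (Derive_n f (S n) u = Derive_n (Derive_n f 1) n u).
  rewrite (Derive_n_comp f n 1 u).
  now replace (n + 1)%nat with (S n) by lia. }
now repeat split; apply E.
Qed.

Lemma smooth_is_derive (g : R -> R3) (s : R) : smooth g ->
  is_derive (fun u => x1 (g u)) s (x1 (deriv g s)) /\
  is_derive (fun u => x2 (g u)) s (x2 (deriv g s)) /\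
  is_derive (fun u => x3 (g u)) s (x3 (deriv g s)).
Proof.
intros hg; destruct (hg 1%nat s) as (h1 & h2 & h3); simpl in *.
now repeat split; apply Derive_correct.
Qed.

Lemma inner_const_deriv (c : Z) (g : R -> R3) (a : R) :
  smooth g -> (forall s, inner c (g s) (g s) = a) ->
  forall s, inner c (g s) (deriv g s) = 0.
Proof.
intros hg ha s; destruct (smooth_is_derive g s hg) as (h1 & h2 & h3).
assert (hd : is_derive (fun u => inner c (g u) (g u)) s
               (2 * inner c (g s) (deriv g s))).
{ unfold inner.
  set (f1 := fun u => x1 (g u)) in *; set (f2 := fun u => x2 (g u)) in *.
  set (f3 := fun u => x3 (g u)) in *.
  change (is_derive (fun u => IZR c * f1 u * f1 u + f2 u * f2 u + f3 u * f3 u) s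
    (2 * (IZR c * f1 s * x1 (deriv g s) + f2 s * x2 (deriv g s)
          + f3 s * x3 (deriv g s)))).
  auto_derive; [repeat split; eexists; eassumption|].
  replace (Derive _ s) with (x1 (deriv g s)) by reflexivity.
  change (Derive (fun x => f2 x) s) with (x2 (deriv g s)).
  change (Derive (fun x => f3 x) s) with (x3 (deriv g s)).
  ring. }
apply is_derive_unique in hd.
rewrite (Derive_ext _ (fun _ => a)) in hd by exact ha.
rewrite Derive_const in hd; lra.
Qed.

Lemma space_form_inner (c : Z) (x : R3) :
  (c = -1 \/ c = 1)%Z -> space_form c x -> inner c x x = IZR c.
Proof. intros [-> | ->]; simpl; tauto. Qed.

Lemma geod_curvatureP (c : Z) (g : R -> R3) (s : R) :
  (c = -1 \/ c = 0 \/ c = 1)%Z -> smooth g ->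
  (forall u, space_form c (g u)) -> arc_length c g ->
  cov_accel c g s = scal (geod_curvature c g s) (frenet_normal c g s).
Proof.
intros hc hg hM hs.
assert (htt : forall u, inner c (deriv g u) (deriv g u) = 1).
{ intros u; generalize (hs u); unfold norm_c; intros h.
  destruct (Rle_or_lt 0 (inner c (deriv g u) (deriv g u))) as [h0|h0].
  - rewrite <- (sqrt_sqrt _ h0), h; ring.
  - rewrite sqrt_neg_0 in h; lra. }
assert (htn := inner_const_deriv c _ 1 (smooth_deriv _ hg) htt s).
assert (H : (c = -1 \/ c = 1)%Z -> inner c (g s) (deriv g s) = 0 /\
            inner c (g s) (g s) = IZR c).
{ intros h; split; [|now apply space_form_inner].
  apply (inner_const_deriv c _ (IZR c) hg).
  now intros u; apply space_form_inner. }
assert (h0 : c = 0%Z -> x1 (deriv (deriv g) s) = 0).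
{ intros ->; unfold deriv at 1; unfold x1 at 1; cbn [fst].
  rewrite (Derive_ext _ (fun _ => 0)); [apply Derive_const|].
  intros u; unfold deriv, x1; cbn [fst].
  rewrite (Derive_ext _ (fun _ => 0)); [apply Derive_const|exact hM]. }
specialize (htt s).
unfold geod_curvature, cov_accel, frenet_normal, tangent.
revert H h0 htt htn; generalize (g s) (deriv g s) (deriv (deriv g) s); clear - hc.
intros p t n H h0 htt htn.
destruct hc as [-> | [-> | ->]].
- destruct (H (or_introl eq_refl)) as [hpt hpp]; clear H h0.
  rewrite coord_minus_scal, coord_scal.
  revert hpt hpp htt htn; unfold inner, wedge, x1, x2, x3; cbn [fst snd].
  intros; repeat apply f_equal2; nsatz.
- specialize (h0 eq_refl); clear H.
  unfold norm_c; rewrite coord_minus_scal, !coord_scal.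
  unfold inner; rewrite h0.
  replace (0 * 0 * 0 + x2 n * x2 n + x3 n * x3 n)
    with (x2 n * x2 n + x3 n * x3 n) by ring.
  generalize (x2 n) (x3 n); clear; intros n2 n3.
  unfold x1, x2, x3; cbn [fst snd].
  assert (hq : 0 <= n2 * n2 + n3 * n3) by nra.
  destruct hq as [hq | hq].
  + assert (hr := sqrt_lt_R0 _ hq).
    assert (hr2 := sqrt_sqrt _ (Rlt_le _ _ hq)).
    set (r := sqrt (n2 * n2 + n3 * n3)) in *.
    assert (hk : / r * / r * (n2 * n2 + n3 * n3) = 1)
      by (rewrite <- hr2; field; lra).
    repeat apply f_equal2.
    * ring.
    * transitivity (n2 * (/ r * / r * (n2 * n2 + n3 * n3))); [rewrite hk|]; ring.
    * transitivity (n3 * (/ r * / r * (n2 * n2 + n3 * n3))); [rewrite hk|]; ring.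
  + assert (n2 = 0) by nra; assert (n3 = 0) by nra; subst.
    repeat apply f_equal2; ring.
- destruct (H (or_intror eq_refl)) as [hpt hpp]; clear H h0.
  rewrite coord_minus_scal, coord_scal.
  revert hpt hpp htt htn; unfold inner, wedge, x1, x2, x3; cbn [fst snd].
  intros; repeat apply f_equal2; nsatz.
Qed.

(** Rotation by +90 degrees in the oriented tangent space at [p]. *)
Definition left_normal (c : Z) (p t : R3) : R3 :=
  match c with
  | Z0 => (0, - x3 t, x2 t)
  | _ => wedge c p t
  end.

(** A closed curve turns counterclockwise when its total signed geodesic
    curvature is positive.  For [c = 0] this integral is 2 pi times the rotation
    index; for a simple closed curve, by Gauss-Bonnet, it is positive exactly
    when the bounded region (on the sphere: a region of area less than 2 pi)
    lies to the left.  The sign is needed because for [c = 0] the frame vector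
    [frenet_normal] does not depend on the direction of travel. *)
Definition positively_oriented (c : Z) (l : R) (g : R -> R3) : Prop :=
  0 < RInt (fun s => inner c (cov_accel c g s)
                       (left_normal c (g s) (tangent g s))) 0 l.

Definition convex (c : Z) (g : R -> R3) : Prop :=
  forall s : R,
    match c with
    | Zneg _ => 1 < geod_curvature c g s
    | _ => 0 < geod_curvature c g s
    end.

Definition v_dir (c : Z) (alpha : R) (g : R -> R3) (s : R) : R3 :=
  plus (scal (cos alpha) (tangent g s)) (scal (sin alpha) (frenet_normal c g s)).

Definition rho (c : Z) (alpha : R) (g : R -> R3) (s : R) : R :=
  arctan_c c (sin alpha / geod_curvature c g s).

Definition evolutoid (c : Z) (alpha : R) (g : R -> R3) (s : R) : R3 :=
  expmap c (g s) (rho c alpha g s) (v_dir c alpha g s).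

Definition regular_on (l : R) (g : R -> R3) : Prop :=
  forall s : R, 0 <= s <= l -> deriv g s <> zero.

(* Main.v *)
Require Import Defs.
From Stdlib Require Import Reals ZArith Lra Nsatz.
From Coquelicot Require Import Coquelicot.
Open Scope R_scope.

(** Differentiate the evolutoid in the moving frame [p = g s], [t], [e].
    Write [k] for the geodesic curvature and [C], [S] for the generalized cosine
    and sine of the distance [rho].  The Frenet equations
    [p' = t], [t' = k e - c p], [e' = - k t] and [C' = - c S rho'],
    [S' = C rho'] give the velocity

      [- c S (rho' + cos alpha) p + (C + C rho' cos alpha - S k sin alpha) t
        + (C rho' sin alpha + S k cos alpha) e].

    Now [rho] is chosen exactly so that [S k = C sin alpha]
    ([sin_c_rho]); with [1 - sin^2 = cos^2] the scalar [rho' + cos alpha] then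
    factors out of every coefficient, and

      [velocity = (rho' + cos alpha) (- c S p + C v)],
      [v = cos alpha t + sin alpha e]

    ([evolutoid_derive]).  The second factor is the parallel transport of the
    unit vector [v] along the geodesic from the curve to its evolutoid.  It
    never vanishes, because its inner product with [v] is [C], and [C > 0]
    ([evolutoid_direction_neq0]).  So the velocity vanishes exactly where
    [rho' = - cos alpha].

    Convexity makes [rho] well defined and differentiable: [k] is positive, and
    for [c = -1] the bound [k > 1] keeps [sin alpha / k] inside the domain of
    the inverse hyperbolic tangent.  For [c = 0] it also makes the principal
    normal [e] differentiable, since [g''] does not vanish. *)

(** * Vector algebra *)

Lemma scal_eq_zero (a : R) (v : R3) : scal a v = zero -> a = 0 \/ v = zero.
Proof.
rewrite coord_scal; intros h.
destruct (Req_dec a 0) as [ha|ha]; [now left|right].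
assert (h1 := f_equal x1 h); assert (h2 := f_equal x2 h).
assert (h3 := f_equal x3 h).
apply R3_eq; apply (Rmult_eq_reg_l a); try exact ha;
  etransitivity; try eassumption; cbn; ring.
Qed.

Lemma inner_plus_r (c : Z) (u v w : R3) :
  inner c u (plus v w) = inner c u v + inner c u w.
Proof.
unfold inner; change (x1 (plus v w)) with (x1 v + x1 w).
change (x2 (plus v w)) with (x2 v + x2 w).
change (x3 (plus v w)) with (x3 v + x3 w); ring.
Qed.

Lemma inner_minus_r (c : Z) (u v w : R3) :
  inner c u (minus v w) = inner c u v - inner c u w.
Proof.
unfold inner; change (x1 (minus v w)) with (x1 v - x1 w).
change (x2 (minus v w)) with (x2 v - x2 w).
change (x3 (minus v w)) with (x3 v - x3 w); ring.
Qed.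

Lemma inner_scal_r (c : Z) (a : R) (v w : R3) :
  inner c v (scal a w) = a * inner c v w.
Proof.
rewrite coord_scal; unfold inner, x1, x2, x3; cbn [fst snd]; ring.
Qed.

Lemma inner_sym (c : Z) (v w : R3) : inner c v w = inner c w v.
Proof. unfold inner; ring. Qed.

Lemma inner_normalize (c : Z) (v : R3) :
  0 < inner c v v ->
  inner c (scal (/ norm_c c v) v) (scal (/ norm_c c v) v) = 1.
Proof.
intros h; rewrite inner_scal_r, inner_sym, inner_scal_r.
rewrite <- (sqrt_sqrt (inner c v v)) by lra; fold (norm_c c v); field.
apply Rgt_not_eq, sqrt_lt_R0, h.
Qed.

Lemma norm_c_eq1 (c : Z) (v : R3) : norm_c c v = 1 -> inner c v v = 1.
Proof.
unfold norm_c; intros h.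
destruct (Rle_or_lt 0 (inner c v v)) as [h0|h0].
- rewrite <- (sqrt_sqrt _ h0), h; ring.
- rewrite sqrt_neg_0 in h; lra.
Qed.

Lemma wedge_self (c : Z) (v : R3) : wedge c v v = zero.
Proof.
change (wedge c v v = (0, 0, 0)).
unfold wedge; repeat apply f_equal2; ring.
Qed.

Lemma wedge_minus_scal (c : Z) (a b : R) (p e : R3) :
  wedge c p (minus (scal a e) (scal b p)) = scal a (wedge c p e).
Proof.
rewrite coord_minus_scal, !coord_scal.
apply R3_eq; unfold wedge, x1, x2, x3; cbn [fst snd]; ring.
Qed.

(** On the tangent plane at [p], the map [wedge c p] is a quarter turn, so its
    square is minus the identity. *)
Lemma wedge_wedge (c : Z) (p t : R3) :
  (c = -1 \/ c = 1)%Z -> inner c p p = IZR c -> inner c p t = 0 ->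
  wedge c p (wedge c p t) = opp t.
Proof.
intros hc hpp hpt.
apply R3_eq; [change (x1 (opp t)) with (- x1 t)
             |change (x2 (opp t)) with (- x2 t)
             |change (x3 (opp t)) with (- x3 t)];
  revert hpp hpt; unfold wedge, inner, x1, x2, x3; cbn [fst snd];
  destruct hc as [-> | ->]; intros; nsatz.
Qed.

(** In the plane [x1 = 0] the vectors [t] and [e] form an orthonormal basis, and
    [w] has no component along [e].  The first coordinates are prescribed
    separately because [inner 0] does not see them. *)
Lemma planar_frame (t e w : R3) :
  x1 t = 0 -> x1 e = 0 -> x1 w = 0 -> inner 0 t t = 1 ->
  inner 0 e e = 1 -> inner 0 t e = 0 -> inner 0 e w = 0 ->
  w = scal (inner 0 t w) t.
Proof.
intros t1 e1 w1; unfold inner; rewrite t1, e1, w1, coord_scal; intros.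
apply R3_eq; unfold x1, x2, x3 in *; cbn [fst snd]; nsatz.
Qed.

(** * Calculus of curves in three-space *)

(** Derivatives are taken coordinatewise, to match [deriv]. *)
Definition is_derive3 (g : R -> R3) (s : R) (v : R3) : Prop :=
  is_derive (fun u => x1 (g u)) s (x1 v) /\
  is_derive (fun u => x2 (g u)) s (x2 v) /\
  is_derive (fun u => x3 (g u)) s (x3 v).

Lemma is_derive3_deriv (g : R -> R3) (s : R) (v : R3) :
  is_derive3 g s v -> deriv g s = v.
Proof.
intros (h1 & h2 & h3).
apply R3_eq; apply is_derive_unique; assumption.
Qed.

Lemma smooth_is_derive3 (g : R -> R3) (s : R) :
  smooth g -> is_derive3 g s (deriv g s).
Proof. exact (smooth_is_derive g s). Qed.

Lemma planar_x1 (g : R -> R3) (v : R3) (s : R) :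
  (forall u, x1 (g u) = 0) -> is_derive3 g s v -> x1 v = 0.
Proof.
intros h0 (h & _ & _); apply is_derive_unique in h.
rewrite (Derive_ext _ (fun _ => 0)), Derive_const in h by exact h0.
now symmetry.
Qed.

Lemma is_derive_Rplus (f g : R -> R) (s a b : R) :
  is_derive f s a -> is_derive g s b ->
  is_derive (fun u => f u + g u) s (a + b).
Proof. exact (is_derive_plus f g s a b). Qed.

Lemma is_derive_Rminus (f g : R -> R) (s a b : R) :
  is_derive f s a -> is_derive g s b ->
  is_derive (fun u => f u - g u) s (a - b).
Proof. exact (is_derive_minus f g s a b). Qed.

Lemma is_derive_Rmult (f g : R -> R) (s a b : R) :
  is_derive f s a -> is_derive g s b ->
  is_derive (fun u => f u * g u) s (a * g s + f s * b).
Proof. intros hf hg; exact (is_derive_mult f g s a b hf hg Rmult_comm). Qed.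

Lemma is_derive_Rconst (a s : R) : is_derive (fun _ => a) s 0.
Proof. exact (is_derive_const a s). Qed.

Lemma is_derive_eq (f : R -> R) (s a b : R) :
  is_derive f s a -> a = b -> is_derive f s b.
Proof. now intros h <-. Qed.

(** The hypotheses are compared syntactically: testing derivatives of different
    coordinates for convertibility unfolds the structures behind [is_derive]. *)
Ltac derive_product :=
  eapply is_derive_eq;
  [ repeat match goal with
    | |- is_derive (fun u => @?a u + @?b u) _ _ => eapply is_derive_Rplus
    | |- is_derive (fun u => @?a u - @?b u) _ _ => eapply is_derive_Rminus
    | |- is_derive (fun u => @?a u * @?b u) _ _ => eapply is_derive_Rmult
    | h : is_derive ?f _ _ |- is_derive ?g _ _ => constr_eq f g; exact h
    | |- is_derive (fun _ => IZR _) _ _ => apply is_derive_Rconst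
    end
  | cbn beta; try ring ].

Lemma is_derive3_plus (g h : R -> R3) (s : R) (v w : R3) :
  is_derive3 g s v -> is_derive3 h s w ->
  is_derive3 (fun u => plus (g u) (h u)) s (plus v w).
Proof.
intros (g1 & g2 & g3) (h1 & h2 & h3).
split; [|split]; apply is_derive_Rplus; assumption.
Qed.

Lemma is_derive3_minus (g h : R -> R3) (s : R) (v w : R3) :
  is_derive3 g s v -> is_derive3 h s w ->
  is_derive3 (fun u => minus (g u) (h u)) s (minus v w).
Proof.
intros (g1 & g2 & g3) (h1 & h2 & h3).
split; [|split]; apply is_derive_Rminus; assumption.
Qed.

Lemma is_derive3_scal (f : R -> R) (g : R -> R3) (s df : R) (v : R3) :
  is_derive f s df -> is_derive3 g s v ->
  is_derive3 (fun u => scal (f u) (g u)) s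
    (plus (scal df (g s)) (scal (f s) v)).
Proof.
intros hf (g1 & g2 & g3).
split; [|split]; apply is_derive_Rmult; assumption.
Qed.

Lemma is_derive_inner (c : Z) (g h : R -> R3) (s : R) (v w : R3) :
  is_derive3 g s v -> is_derive3 h s w ->
  is_derive (fun u => inner c (g u) (h u)) s
    (inner c v (h s) + inner c (g s) w).
Proof.
intros (g1 & g2 & g3) (h1 & h2 & h3); unfold inner; derive_product.
Qed.

Lemma is_derive3_wedge (c : Z) (g h : R -> R3) (s : R) (v w : R3) :
  is_derive3 g s v -> is_derive3 h s w ->
  is_derive3 (fun u => wedge c (g u) (h u)) s
    (plus (wedge c v (h s)) (wedge c (g s) w)).
Proof.
intros (g1 & g2 & g3) (h1 & h2 & h3).
split; [|split].
- change (is_derive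
    (fun u => IZR c * (x2 (g u) * x3 (h u) - x3 (g u) * x2 (h u))) s
    (IZR c * (x2 v * x3 (h s) - x3 v * x2 (h s)) +
     IZR c * (x2 (g s) * x3 w - x3 (g s) * x2 w))); derive_product.
- change (is_derive (fun u => x3 (g u) * x1 (h u) - x1 (g u) * x3 (h u)) s
    (x3 v * x1 (h s) - x1 v * x3 (h s) +
     (x3 (g s) * x1 w - x1 (g s) * x3 w))); derive_product.
- change (is_derive (fun u => x1 (g u) * x2 (h u) - x2 (g u) * x1 (h u)) s
    (x1 v * x2 (h s) - x2 v * x1 (h s) +
     (x1 (g s) * x2 w - x2 (g s) * x1 w))); derive_product.
Qed.

(** * Trigonometry of the space forms *)

Lemma is_derive_sin_c (c : Z) (t : R) : is_derive (sin_c c) t (cos_c c t).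
Proof.
destruct c as [|p|p]; simpl.
- apply (is_derive_id t).
- apply is_derive_sin.
- apply is_derive_Reals, derivable_pt_lim_sinh.
Qed.

Lemma is_derive_cos_c (c : Z) (t : R) :
  (c = -1 \/ c = 0 \/ c = 1)%Z ->
  is_derive (cos_c c) t (- IZR c * sin_c c t).
Proof.
intros [-> | [-> | ->]]; eapply is_derive_eq.
- apply is_derive_Reals, derivable_pt_lim_cosh.
- simpl; ring.
- apply is_derive_Rconst.
- simpl; ring.
- apply is_derive_cos.
- simpl; ring.
Qed.

Lemma ex_derive_arctan_c (c : Z) (x : R) :
  ((c < 0)%Z -> -1 < x < 1) -> ex_derive (arctan_c c) x.
Proof.
intros hx; destruct c as [|p|p]; simpl.
- apply ex_derive_id.
- eexists; apply is_derive_atan.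
- assert (h := hx (Zlt_neg_0 p)).
  unfold arctan_c.
  auto_derive; split; [lra|split; [|exact I]].
  apply Rdiv_lt_0_compat; lra.
Qed.

Lemma cos_c_arctan_c_pos (c : Z) (x : R) : 0 < cos_c c (arctan_c c x).
Proof.
destruct c as [|p|p]; simpl.
- lra.
- destruct (atan_bound x); apply cos_gt_0; lra.
- unfold cosh.
  assert (h := exp_pos (/ 2 * ln ((1 + x) / (1 - x)))).
  assert (h' := exp_pos (- (/ 2 * ln ((1 + x) / (1 - x))))).
  lra.
Qed.

Lemma sin_c_arctan_c (c : Z) (x : R) :
  ((c < 0)%Z -> -1 < x < 1) ->
  sin_c c (arctan_c c x) = x * cos_c c (arctan_c c x).
Proof.
intros hx.
rewrite <- (tan_c_arctan_c c x hx) at 2; unfold tan_c; field.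
apply Rgt_not_eq, cos_c_arctan_c_pos.
Qed.

(** * The Frenet frame *)

Record convex_unit_curve (c : Z) (g : R -> R3) : Prop := {
  cuc_sign : (c = -1 \/ c = 0 \/ c = 1)%Z;
  cuc_smooth : smooth g;
  cuc_space_form : forall s, space_form c (g s);
  cuc_arc_length : arc_length c g;
  cuc_convex : convex c g }.

Lemma curvature_pos (c : Z) (g : R -> R3) (s : R) :
  convex c g -> 0 < geod_curvature c g s.
Proof.
intros hk; generalize (hk s); destruct c as [|p|p]; lra.
Qed.

(** The factor [IZR c] makes one relation cover all three signs: for [c = 0] the
    position is in general not orthogonal to the tangent. *)
Lemma inner_position_tangent (c : Z) (g : R -> R3) (s : R) :
  convex_unit_curve c g -> IZR c * inner c (g s) (tangent g s) = 0.
Proof.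
intros [hc hg hM _ _].
assert (h : (c = -1 \/ c = 1)%Z -> inner c (g s) (tangent g s) = 0).
{ intros h; apply (inner_const_deriv c _ (IZR c) hg).
  now intros u; apply space_form_inner. }
destruct hc as [hc | [-> | hc]]; [|ring|]; rewrite h by tauto; ring.
Qed.

Lemma inner_tangent_tangent (c : Z) (g : R -> R3) (s : R) :
  convex_unit_curve c g -> inner c (tangent g s) (tangent g s) = 1.
Proof. intros [_ _ _ h _]; exact (norm_c_eq1 _ _ (h s)). Qed.

Lemma inner_accel_tangent (c : Z) (g : R -> R3) (s : R) :
  convex_unit_curve c g -> inner c (tangent g s) (deriv (tangent g) s) = 0.
Proof.
intros h; apply (inner_const_deriv c _ 1).
- apply smooth_deriv, h.
- intros u; now apply inner_tangent_tangent.
Qed.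

(** Differentiate the orthogonality of position and tangent. *)
Lemma inner_accel_position (c : Z) (g : R -> R3) (s : R) :
  convex_unit_curve c g ->
  IZR c * inner c (deriv (tangent g) s) (g s) = - IZR c.
Proof.
intros h.
assert (hd : is_derive (fun u => IZR c * inner c (g u) (tangent g u)) s
  (0 * inner c (g s) (tangent g s) + IZR c *
   (inner c (tangent g s) (tangent g s) +
    inner c (g s) (deriv (tangent g) s)))).
{ apply (is_derive_Rmult (fun _ => IZR c)); [apply is_derive_Rconst|].
  apply is_derive_inner; apply smooth_is_derive3; [|apply smooth_deriv]; apply h. }
apply is_derive_unique in hd.
rewrite (Derive_ext _ (fun _ => 0)), Derive_const in hd
  by now intros u; apply inner_position_tangent.
rewrite inner_tangent_tangent in hd by assumption.
rewrite inner_sym; lra.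
Qed.

(** The component of the acceleration normal to the surface is forced by
    [inner_accel_position]; the one tangent to it is given by
    [geod_curvatureP]. *)
Lemma frenet_tangent (c : Z) (g : R -> R3) (s : R) :
  convex_unit_curve c g ->
  deriv (tangent g) s =
  minus (scal (geod_curvature c g s) (frenet_normal c g s))
        (scal (IZR c) (g s)).
Proof.
intros h.
rewrite <- (geod_curvatureP c g s) by apply h.
unfold cov_accel; fold (tangent g); rewrite inner_accel_position by assumption.
apply R3_eq; rewrite !coord_minus_scal; unfold x1, x2, x3; cbn [fst snd]; ring.
Qed.

(** For [c = 0] the curvature is the length of the acceleration, so convexity
    excludes a vanishing acceleration, where the principal normal would be
    undefined. *)
Lemma planar_accel_pos (g : R -> R3) (s : R) :
  convex_unit_curve 0 g ->
  0 < inner 0 (deriv (tangent g) s) (deriv (tangent g) s).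
Proof.
intros h; assert (hk := curvature_pos 0 g s (cuc_convex _ _ h)).
revert hk; unfold geod_curvature, cov_accel, frenet_normal, tangent.
rewrite coord_minus_scal, coord_scal; unfold inner.
generalize (deriv (deriv g) s); intros [[a b] d].
unfold norm_c, inner, x1, x2, x3; cbn [fst snd]; intros hk.
destruct (Req_dec b 0) as [-> | hb]; [|nra].
destruct (Req_dec d 0) as [-> | hd]; [|nra].
ring_simplify in hk; lra.
Qed.

Lemma inner_normal (c : Z) (g : R -> R3) (s : R) :
  convex_unit_curve c g ->
  inner c (frenet_normal c g s) (frenet_normal c g s) = 1 /\
  inner c (tangent g s) (frenet_normal c g s) = 0 /\
  IZR c * inner c (g s) (frenet_normal c g s) = 0.
Proof.
intros h.
assert (htt := inner_tangent_tangent c g s h).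
assert (hta := inner_accel_tangent c g s h).
assert (hpt := inner_position_tangent c g s h).
assert (hpp : (c = -1 \/ c = 1)%Z -> inner c (g s) (g s) = IZR c)
  by (intros hc; apply space_form_inner, h; exact hc).
assert (hpos := fun h0 : c = 0%Z =>
  planar_accel_pos g s (eq_ind c (fun c => convex_unit_curve c g) h 0%Z h0)).
destruct (cuc_sign _ _ h) as [-> | [-> | ->]].
- specialize (hpp (or_introl eq_refl)); clear - htt hpt hpp.
  unfold frenet_normal; revert htt hpt hpp.
  unfold wedge, inner, x1, x2, x3; cbn [fst snd].
  intros; repeat split; nsatz.
- specialize (hpos eq_refl); clear - hta hpos.
  change (frenet_normal 0 g s) with
    (scal (/ norm_c 0 (deriv (tangent g) s)) (deriv (tangent g) s)).
  rewrite inner_normalize, inner_scal_r, hta by exact hpos.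
  repeat split; ring.
- specialize (hpp (or_intror eq_refl)); clear - htt hpt hpp.
  unfold frenet_normal; revert htt hpt hpp.
  unfold wedge, inner, x1, x2, x3; cbn [fst snd].
  intros; repeat split; nsatz.
Qed.

Lemma ex_derive_normal_planar (g : R -> R3) (s : R) :
  convex_unit_curve 0 g -> exists w, is_derive3 (frenet_normal 0 g) s w.
Proof.
intros h; assert (hpos := planar_accel_pos g s h).
assert (ha : is_derive3 (deriv (deriv g)) s (deriv (deriv (deriv g)) s)).
{ now apply smooth_is_derive3, smooth_deriv, smooth_deriv, h. }
assert (hi := is_derive_inner 0 _ _ s _ _ ha ha).
assert (hf : ex_derive (fun u => / norm_c 0 (deriv (deriv g) u)) s).
{ apply ex_derive_inv.
  - apply (ex_derive_comp sqrt); [|eexists; exact hi].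
    eexists; apply is_derive_Reals, derivable_pt_lim_sqrt; exact hpos.
  - apply Rgt_not_eq, sqrt_lt_R0; exact hpos. }
destruct hf as [df hf].
eexists; apply (is_derive3_scal _ _ _ _ _ hf ha).
Qed.

(** For [c = -1, 1] this is the product rule applied to [wedge c p t], together
    with [wedge_wedge].  For [c = 0] the normal is given by normalizing the
    acceleration, and its sign relative to a rotation of [t] is not known; the
    derivative is found instead by differentiating the relations
    [<e, e> = 1] and [<t, e> = 0]. *)
Lemma frenet_normal_derive (c : Z) (g : R -> R3) (s : R) :
  convex_unit_curve c g ->
  is_derive3 (frenet_normal c g) s
    (scal (- geod_curvature c g s) (tangent g s)).
Proof.
intros h.
assert (ht := frenet_tangent c g s h).
assert (dp : is_derive3 g s (tangent g s)) by apply smooth_is_derive3, h.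
assert (dt : is_derive3 (tangent g) s (deriv (tangent g) s))
  by now apply smooth_is_derive3, smooth_deriv, h.
assert (htt := inner_tangent_tangent c g s h).
assert (hpt := inner_position_tangent c g s h).
assert (hw : c <> 0%Z -> is_derive3 (frenet_normal c g) s
          (plus (wedge c (tangent g s) (tangent g s))
                (wedge c (g s) (deriv (tangent g) s)))).
{ intros hc; generalize (is_derive3_wedge c g (tangent g) s _ _ dp dt).
  destruct c; [easy| |]; exact (fun x => x). }
assert (hpp : (c = -1 \/ c = 1)%Z -> inner c (g s) (g s) = IZR c)
  by (intros hc; apply space_form_inner, h; exact hc).
assert (hn := fun u => inner_normal c g u h).
assert (hcase : (c = 0 \/ (c = -1 \/ c = 1))%Z)
  by (destruct (cuc_sign _ _ h) as [H|[H|H]]; tauto).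
destruct hcase as [-> | hc].
- destruct (ex_derive_normal_planar g s h) as [w dw].
  assert (hM : forall u, x1 (g u) = 0) by exact (cuc_space_form _ _ h).
  assert (t1 : forall u, x1 (tangent g u) = 0).
  { intros u; apply (planar_x1 g _ u hM), smooth_is_derive3, h. }
  assert (a1 : forall u, x1 (deriv (tangent g) u) = 0).
  { intros u; apply (planar_x1 (tangent g) _ u t1).
    now apply smooth_is_derive3, smooth_deriv, h. }
  assert (e1 : forall u, x1 (frenet_normal 0 g u) = 0).
  { intros u; unfold frenet_normal; rewrite coord_scal.
    unfold x1 at 1; cbn [fst]; fold (deriv (tangent g) u); rewrite a1; ring. }
  assert (w1 := planar_x1 _ _ s e1 dw).
  destruct (hn s) as (hee & hte & _).
  assert (hew : inner 0 (frenet_normal 0 g s) w = 0).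
  { assert (hd := is_derive_inner 0 _ _ s _ _ dw dw).
    apply is_derive_unique in hd.
    rewrite (Derive_ext _ (fun _ => 1)), Derive_const in hd by apply hn.
    rewrite (inner_sym 0 w) in hd; lra. }
  assert (htw : inner 0 (tangent g s) w = - geod_curvature 0 g s).
  { assert (hd := is_derive_inner 0 _ _ s _ _ dt dw).
    apply is_derive_unique in hd.
    rewrite (Derive_ext _ (fun _ => 0)), Derive_const in hd by apply hn.
    rewrite inner_sym, ht, inner_minus_r, !inner_scal_r, hee in hd; lra. }
  rewrite <- htw, <- (planar_frame (tangent g s) (frenet_normal 0 g s) w);
    auto.
- replace (scal (- geod_curvature c g s) (tangent g s))
    with (plus (wedge c (tangent g s) (tangent g s))
               (wedge c (g s) (deriv (tangent g) s)));
    [destruct hc as [-> | ->]; now apply hw|].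
  rewrite ht, wedge_self, wedge_minus_scal.
  replace (frenet_normal c g s) with (wedge c (g s) (tangent g s))
    by now destruct hc as [-> | ->].
  rewrite wedge_wedge; [|exact hc|now apply hpp|].
  + apply R3_eq; cbn; ring.
  + destruct hc as [-> | ->]; lra.
Qed.

Lemma ex_derive_curvature (c : Z) (g : R -> R3) (s : R) :
  convex_unit_curve c g -> ex_derive (geod_curvature c g) s.
Proof.
intros h.
assert (dp := smooth_is_derive3 g s (cuc_smooth _ _ h)).
assert (da : is_derive3 (deriv (deriv g)) s (deriv (deriv (deriv g)) s))
  by now apply smooth_is_derive3, smooth_deriv, smooth_deriv, h.
assert (dc := is_derive_inner c _ _ s _ _ da dp).
assert (dcc := is_derive_Rmult _ _ _ _ _ (is_derive_Rconst (IZR c) s) dc).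
assert (dcov := is_derive3_minus _ _ _ _ _ da
                  (is_derive3_scal _ _ _ _ _ dcc dp)).
eexists; exact (is_derive_inner c _ _ s _ _ dcov (frenet_normal_derive c g s h)).
Qed.

(** * The velocity of an evolutoid *)

Lemma arctan_c_argument (c : Z) (alpha : R) (g : R -> R3) (s : R) :
  convex_unit_curve c g -> (c < 0)%Z ->
  -1 < sin alpha / geod_curvature c g s < 1.
Proof.
intros h hc; assert (hk := cuc_convex _ _ h s).
destruct c as [|p|p]; try easy.
revert hk; generalize (geod_curvature (Z.neg p) g s); intros k hk.
destruct (SIN_bound alpha).
split; [apply Rlt_div_r|apply Rlt_div_l]; lra.
Qed.

Lemma ex_derive_rho (c : Z) (alpha : R) (g : R -> R3) (s : R) :
  convex_unit_curve c g -> ex_derive (rho c alpha g) s.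
Proof.
intros h; unfold rho.
apply (ex_derive_comp (arctan_c c)).
- now apply ex_derive_arctan_c, arctan_c_argument.
- apply (ex_derive_div (fun _ => sin alpha)).
  + apply ex_derive_const.
  + now apply ex_derive_curvature.
  + apply Rgt_not_eq, curvature_pos, h.
Qed.

Lemma cos_c_rho_pos (c : Z) (alpha : R) (g : R -> R3) (s : R) :
  0 < cos_c c (rho c alpha g s).
Proof. apply cos_c_arctan_c_pos. Qed.

(** This is [tan_c rho = sin alpha / k] with denominators cleared. *)
Lemma sin_c_rho (c : Z) (alpha : R) (g : R -> R3) (s : R) :
  convex_unit_curve c g ->
  sin_c c (rho c alpha g s) * geod_curvature c g s =
  sin alpha * cos_c c (rho c alpha g s).
Proof.
intros h; unfold rho; rewrite sin_c_arctan_c by now apply arctan_c_argument.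
field; apply Rgt_not_eq, curvature_pos, h.
Qed.

(** The velocity at time [rho] of the unit speed geodesic that leaves [g s] in the
    direction [v_dir]. *)
Definition evolutoid_direction (c : Z) (alpha : R) (g : R -> R3) (s : R) : R3 :=
  plus (scal (- IZR c * sin_c c (rho c alpha g s)) (g s))
       (scal (cos_c c (rho c alpha g s)) (v_dir c alpha g s)).

Lemma evolutoid_derive (c : Z) (alpha : R) (g : R -> R3) (s : R) :
  convex_unit_curve c g ->
  deriv (evolutoid c alpha g) s =
  scal (Derive (rho c alpha g) s + cos alpha) (evolutoid_direction c alpha g s).
Proof.
intros h.
assert (dr : is_derive (rho c alpha g) s (Derive (rho c alpha g) s))
  by now apply Derive_correct, ex_derive_rho.
assert (dC := is_derive_comp _ _ _ _ _
  (is_derive_cos_c c (rho c alpha g s) (cuc_sign _ _ h)) dr).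
assert (dS := is_derive_comp _ _ _ _ _ (is_derive_sin_c c (rho c alpha g s)) dr).
assert (dp : is_derive3 g s (tangent g s)) by apply smooth_is_derive3, h.
assert (dt : is_derive3 (tangent g) s (deriv (tangent g) s))
  by now apply smooth_is_derive3, smooth_deriv, h.
assert (dv := is_derive3_plus _ _ _ _ _
  (is_derive3_scal _ _ _ _ _ (is_derive_Rconst (cos alpha) s) dt)
  (is_derive3_scal _ _ _ _ _ (is_derive_Rconst (sin alpha) s)
     (frenet_normal_derive c g s h))).
assert (dE := is_derive3_plus _ _ _ _ _ (is_derive3_scal _ _ _ _ _ dC dp)
                (is_derive3_scal _ _ _ _ _ dS dv)).
apply is_derive3_deriv in dE.
etransitivity; [exact dE|]; clear dE.
rewrite (frenet_tangent c g s h).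
assert (hSk := sin_c_rho c alpha g s h).
assert (hcs := sin2_cos2 alpha); unfold Rsqr in hcs.
unfold evolutoid_direction, v_dir.
revert hSk hcs; generalize (sin_c c (rho c alpha g s)) (cos_c c (rho c alpha g s))
  (Derive (rho c alpha g) s) (sin alpha) (cos alpha) (geod_curvature c g s)
  (frenet_normal c g s) (tangent g s) (g s) (IZR c).
clear; intros S C r' sa ca k e t p c hSk hcs.
(* In every coordinate the sides differ by
   (S k - sa C) (ca e - sa t) + C (1 - sa^2 - ca^2) t. *)
apply R3_eq; cbn; nsatz.
Qed.

(** Its inner product with [v_dir] is [cos_c rho], because [v_dir] is a unit vector
    orthogonal to the position when [c] is not zero. *)
Lemma evolutoid_direction_neq0 (c : Z) (alpha : R) (g : R -> R3) (s : R) :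
  convex_unit_curve c g -> evolutoid_direction c alpha g s <> zero.
Proof.
intros h h0.
assert (hC := cos_c_rho_pos c alpha g s).
assert (hcs := sin2_cos2 alpha); unfold Rsqr in hcs.
destruct (inner_normal c g s h) as (hee & hte & hpe).
assert (htt := inner_tangent_tangent c g s h).
assert (hpt := inner_position_tangent c g s h).
set (v := v_dir c alpha g s).
assert (hvv : inner c v v = 1).
{ unfold v, v_dir; rewrite inner_plus_r, !inner_scal_r.
  rewrite !(inner_sym c (plus _ _)), !inner_plus_r, !inner_scal_r.
  rewrite htt, hee, (inner_sym c (frenet_normal c g s) (tangent g s)), hte; lra. }
assert (hpv : IZR c * inner c (g s) v = 0).
{ unfold v, v_dir; rewrite inner_plus_r, !inner_scal_r.
  transitivity (cos alpha * (IZR c * inner c (g s) (tangent g s)) +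
    sin alpha * (IZR c * inner c (g s) (frenet_normal c g s))); [ring|].
  rewrite hpt, hpe; ring. }
apply (Rgt_not_eq _ _ hC).
transitivity (inner c v (evolutoid_direction c alpha g s)).
- unfold evolutoid_direction; fold v; rewrite inner_plus_r, !inner_scal_r, hvv.
  rewrite (inner_sym c v).
  transitivity (- sin_c c (rho c alpha g s) * (IZR c * inner c (g s) v) +
    cos_c c (rho c alpha g s)); [rewrite hpv|]; ring.
- rewrite h0; unfold inner, x1, x2, x3; cbn; ring.
Qed.

Theorem theorem1 (c : Z) (alpha l : R) (gamma : R -> R3)
  (hc : (c = -1 \/ c = 0 \/ c = 1)%Z)
  (halpha : 0 < alpha <= PI / 2)
  (hl : 0 < l)
  (hM : forall s : R, space_form c (gamma s))
  (hsmooth : smooth gamma)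
  (hclosed : closed_curve l gamma)
  (harc : arc_length c gamma)
  (horient : positively_oriented c l gamma)
  (hconvex : convex c gamma) :
  regular_on l (evolutoid c alpha gamma) <->
  (forall s : R, 0 <= s <= l -> Derive (rho c alpha gamma) s <> - cos alpha).
Proof.
assert (h : convex_unit_curve c gamma) by now split.
unfold regular_on.
split; intros H s hs E; apply (H s hs).
- rewrite (evolutoid_derive c alpha gamma s h), E.
  replace (- cos alpha + cos alpha) with (@zero R_Ring) by (cbn; ring).
  exact (scal_zero_l _).
- rewrite (evolutoid_derive c alpha gamma s h) in E.
  destruct (scal_eq_zero _ _ E) as [H0|H0]; [lra|].
  now destruct (evolutoid_direction_neq0 c alpha gamma s h).
Qed.
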